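(* Let $ABC$ be an arbitrary (non-degenerate) triangle in the Euclidean plane with centroid $G$. Let $A_1,B_1,C_1$ form a non-overlapping Napoleon's configuration for triangle $ABC$. Let $A_2,B_2,C_2$ be the midpoints of $B_1C_1$, $C_1A_1$, $A_1B_1$ respectively, and let $G_1,G_2,G_3$ be the centroids of triangles $A_1BC$, $AB_1C$, $ABC_1$ respectively. Then: 1. The triangles $A_2B_2C$, $AB_2C_2$ and $A_2BC_2$ are equilateral. 2. The centroids $A^{*},B^{*},C^{*}$ of triangles $AB_2C_2$, $A_2BC_2$, $A_2B_2C$ respectively are the vertices of an equilateral triangle whose centroid coincides with $G$. Similarly, let $A_1',B_1',C_1'$ form an overlapping Napoleon's configuration for triangle $ABC$. Let $A_2',B_2',C_2'$ be the midpoints of $B_1'C_1'$, $C_1'A_1'$, $A_1'B_1'$ respectively, and let $G_1',G_2',G_3'$ be the centroids of triangles $A_1'BC$, $AB_1'C$, $ABC_1'$ respectively. Then: 3. The triangles $A_2'B_2'C$, $AB_2'C_2'$ and $A_2'BC_2'$ are equilateral. 4. The centroids $A^{**},B^{**},C^{**}$ of triangles $AB_2'C_2'$, $A_2'BC_2'$, $A_2'B_2'C$ respectively are the vertices of an equilateral triangle whose centroid coincides with $G$. 5. Triangle $A^{*}B^{*}C^{*}$ is homothetic to triangle $G_1'G_2'G_3'$ with homothetic center $G$ and coefficient of similarity $-1/2$; that is, the homothety with center $G$ and ratio $-1/2$ maps $G_1',G_2',G_3'$ to $A^{*},B^{*},C^{*}$ respectively. 6. Triangle $A^{**}B^{**}C^{**}$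 is homothetic to triangle $G_1G_2G_3$ with homothetic center $G$ and coefficient of similarity $-1/2$; that is, the homothety with center $G$ and ratio $-1/2$ maps $G_1,G_2,G_3$ to $A^{**},B^{**},C^{**}$ respectively. 7. The area of triangle $ABC$ equals four times the algebraic sum of the areas of triangles $A^{*}B^{*}C^{*}$ and $A^{**}B^{**}C^{**}$; that is, with signed (oriented) areas, $[ABC]=4\big([A^{*}B^{*}C^{*}]+[A^{**}B^{**}C^{**}]\big)$.
   Context: Points $A_1,B_1,C_1$ form a non-overlapping Napoleon's configuration for triangle $ABC$ if the triangles $ABC_1$, $AB_1C$ and $A_1BC$ are equilateral and none of them overlaps with triangle $ABC$ (i.e. $C_1$ and $C$ lie on opposite sides of line $AB$, $B_1$ and $B$ on opposite sides of line $AC$, $A_1$ and $A$ on opposite sides of line $BC$). Points $A_1',B_1',C_1'$ form an overlapping Napoleon's configuration for triangle $ABC$ if the triangles $ABC_1'$, $AB_1'C$ and $A_1'BC$ are equilateral and all of them overlap with triangle $ABC$ (i.e. $C_1'$ and $C$ lie on the same side of line $AB$, $B_1'$ and $B$ on the same side of line $AC$, $A_1'$ and $A$ on the same side of line $BC$). Convention: in the conclusions, ''equilateral'' means that the three side lengths are equal, and the degenerate case in which all three vertices coincide is allowed (for instance $A^{*}=B^{*}=C^{*}=G$ when $ABC$ is equilateral). The centroid of three points is their arithmetic mean. For labelled points $P,Q,R$, $[PQR]$ denotes the signed area, positive if $P,Q,R$ are in counterclockwise order and negative if they are in clockwise order. *)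

(* Defs.v *)
From mathcomp Require Import all_boot all_order all_algebra.
From mathcomp Require Import reals.

Set Implicit Arguments.
Unset Strict Implicit.
Unset Printing Implicit Defensive.

Import Order.TTheory GRing.Theory Num.Theory.

Local Open Scope ring_scope.

Section PlaneGeometry.
Variable R : realType.

(* The Euclidean plane; the distance is defined by hand because the norm that
   MathComp-Analysis puts on row vectors is the sup norm. *)
Definition point := 'rV[R]_2.

Implicit Types (A B C G P Q X : point) (k : R).

Definition edist P Q : R := Num.sqrt (\sum_(i < 2) (P 0 i - Q 0 i) ^+ 2).

(* Only equality of the side lengths is required: three coincident points
   are equilateral. *)
Definition equilateral A B C : Prop :=
  edist A B = edist B C /\ edist B C = edist C A.

Definition midpoint P Q : point := 2^-1 *: (P + Q).

Definition centroid A B C : point := 3^-1 *: (A + B + C).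

Definition homothety G k P : point := G + k *: (P - G).

Definition signed_area A B C : R :=
  2^-1 * \det (col_mx (B - A) (C - A) : 'M[R]_2).

(* A genuine line only when P != Q. *)
Definition on_line P Q X : Prop := exists t : R, X = P + t *: (Q - P).

Definition on_segment P Q X : Prop :=
  exists t : R, 0 <= t <= 1 /\ X = P + t *: (Q - P).

Definition collinear A B C : Prop :=
  exists P Q, [/\ P != Q, on_line P Q A, on_line P Q B & on_line P Q C].

Definition segment_meets_line A B P Q : Prop :=
  exists X, on_segment P Q X /\ on_line A B X.

(* P and Q lie strictly on opposite sides, resp. the same side, of line AB. *)
Definition opposite_sides A B P Q : Prop :=
  [/\ ~ on_line A B P, ~ on_line A B Q & segment_meets_line A B P Q].

Definition same_side A B P Q : Prop :=
  [/\ ~ on_line A B P, ~ on_line A B Q & ~ segment_meets_line A B P Q].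

Definition napoleon_nonoverlapping A B C A1 B1 C1 : Prop :=
  [/\ equilateral A B C1, equilateral A B1 C & equilateral A1 B C] /\
  [/\ opposite_sides A B C1 C, opposite_sides A C B1 B
    & opposite_sides B C A1 A].

Definition napoleon_overlapping A B C A1 B1 C1 : Prop :=
  [/\ equilateral A B C1, equilateral A B1 C & equilateral A1 B C] /\
  [/\ same_side A B C1 C, same_side A C B1 B & same_side B C A1 A].

End PlaneGeometry.

(* Main.v *)
(* Write J for the quarter turn. An equilateral triangle on P Q with nonzero
   base has third vertex (P + Q) / 2 + k J (Q - P), where k ^ 2 = 3 / 4 and the
   sign of k is its orientation. The side conditions force the same k for the
   three triangles of a Napoleon configuration erected on AB, BC, CA: k has
   the sign of [ABC] in the overlapping case and the opposite sign in the
   other. Hence the two configurations differ by k -> - k, and every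
   conclusion is a polynomial identity modulo k ^ 2 = 3 / 4. *)
Require Import Defs.
From mathcomp Require Import all_boot all_order all_algebra.
From mathcomp Require Import reals.
From mathcomp Require Import ring lra.

Set Implicit Arguments.
Unset Strict Implicit.
Unset Printing Implicit Defensive.

Import Order.TTheory GRing.Theory Num.Theory.

Local Open Scope ring_scope.

Section NapoleonConfigurations.
Variable R : realType.
Implicit Types (A B C P Q X : point R) (k : R).

(** * Coordinates and squared distances *)

Lemma point_eq P Q : P 0 0 = Q 0 0 -> P 0 1 = Q 0 1 -> P = Q.
Proof.
move=> h0 h1; apply/rowP => i.
case: i => [[|[|//]] hi].
- by rewrite (_ : Ordinal hi = 0) //; apply: val_inj.
- by rewrite (_ : Ordinal hi = 1) //; apply: val_inj.
Qed.

Definition sqdist P Q : R := (P 0 0 - Q 0 0) ^+ 2 + (P 0 1 - Q 0 1) ^+ 2.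

Lemma edistE P Q : edist P Q = Num.sqrt (sqdist P Q).
Proof.
rewrite /edist big_ord_recl big_ord1 (_ : lift _ _ = 1) //.
exact: val_inj.
Qed.

Lemma sqdist_ge0 P Q : 0 <= sqdist P Q.
Proof. by rewrite addr_ge0 ?sqr_ge0. Qed.

Lemma sqdist_gt0 P Q : P != Q -> 0 < sqdist P Q.
Proof.
move=> neqPQ; rewrite lt_neqAle sqdist_ge0 andbT eq_sym.
apply: contraNneq neqPQ => /eqP.
rewrite paddr_eq0 ?sqr_ge0 // !sqrf_eq0 !subr_eq0 => /andP[/eqP h0 /eqP h1].
by apply/eqP/point_eq.
Qed.

Lemma equilateralE A B C :
  equilateral A B C <-> sqdist A B = sqdist B C /\ sqdist B C = sqdist C A.
Proof.
rewrite /equilateral !edistE; split=> [[/eqP h1 /eqP h2]|[-> ->]//].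
by move: h1 h2; rewrite !eqr_sqrt ?sqdist_ge0 // => /eqP-> /eqP->.
Qed.

Lemma equilateral_rot A B C : equilateral A B C -> equilateral B C A.
Proof. by case=> h1 h2; split; rewrite // -h2 -h1. Qed.

(** * Signed areas, lines and sides of a line *)

Definition cross A B C : R :=
  (B 0 0 - A 0 0) * (C 0 1 - A 0 1) - (B 0 1 - A 0 1) * (C 0 0 - A 0 0).

Lemma det_mx2 (M : 'M[R]_2) : \det M = M 0 0 * M 1 1 - M 0 1 * M 1 0.
Proof.
have lift0 : lift 0 0 = 1 :> 'I_2 by apply: val_inj.
have lift1 : lift 1 0 = 0 :> 'I_2 by apply: val_inj.
rewrite (expand_det_row _ 0) big_ord_recl big_ord1 /cofactor !det_mx11 !mxE.
by rewrite !lift0 lift1 /=; ring.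
Qed.

Lemma signed_areaE A B C : signed_area A B C = 2^-1 * cross A B C.
Proof.
have row0 (u v : 'rV[R]_2) j : (col_mx u v : 'M_2) 0 j = u 0 j.
  by rewrite -(col_mxEu u v); congr (col_mx u v _ _); apply: val_inj.
have row1 (u v : 'rV[R]_2) j : (col_mx u v : 'M_2) 1 j = v 0 j.
  by rewrite -(col_mxEd u v); congr (col_mx u v _ _); apply: val_inj.
by rewrite /signed_area det_mx2 !row0 !row1 !mxE.
Qed.

Lemma cross_rot A B C : cross B C A = cross A B C.
Proof. by rewrite /cross; ring. Qed.

Lemma cross_swap A B C : cross B A C = - cross A B C.
Proof. by rewrite /cross; ring. Qed.

Lemma crossAA A C : cross A A C = 0.
Proof. by rewrite /cross; ring. Qed.

Lemma on_lineE P Q X : P != Q -> on_line P Q X <-> cross P Q X = 0.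
Proof.
move=> neqPQ; split=> [[t ->]|h]; first by rewrite /cross !mxE; ring.
have n0 : sqdist P Q != 0 by rewrite gt_eqF ?sqdist_gt0.
(* The parameter of the orthogonal projection of [X] on the line [P Q]; since [cross P Q X]
   vanishes, [X] is its own projection. *)
exists (((X 0 0 - P 0 0) * (Q 0 0 - P 0 0) +
         (X 0 1 - P 0 1) * (Q 0 1 - P 0 1)) / sqdist P Q).
apply: point_eq; rewrite !mxE; apply: (canRL (addNKr _));
  apply: (mulIf n0); rewrite mulrAC divfK //; move: h; rewrite /cross /sqdist.
- by move=> /(congr1 ( *%R (Q 0 1 - P 0 1))); lra.
- by move=> /(congr1 ( *%R (Q 0 0 - P 0 0))); lra.
Qed.

(** [collinear] asks for a line through two distinct points, so coincident vertices are treated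
    apart; if all three coincide, a second point is made by translating [A]. *)
Lemma noncollinear_cross A B C : ~ collinear A B C -> cross A B C != 0.
Proof.
move=> ncol; apply/eqP => h0; apply: ncol.
have [AB|neqAB] := eqVneq A B; last first.
  by exists A, B; split=> //; apply/on_lineE => //; rewrite /cross; ring.
have [AC|neqAC] := eqVneq A C; last first.
  by exists A, C; split=> //; apply/on_lineE; rewrite // -?AB /cross; ring.
have neqA : A != A + const_mx 1.
  by apply/eqP => /rowP /(_ 0); rewrite !mxE; lra.
by exists A, (A + const_mx 1); rewrite -AB -AC; split=> //;
  apply/on_lineE; rewrite // /cross; ring.
Qed.

Lemma cross_segment P Q A B t :
  cross A B (P + t *: (Q - P)) = (1 - t) * cross A B P + t * cross A B Q.
Proof. by rewrite /cross !mxE; ring. Qed.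

(** Let [p], [q] be the values of [cross A B] at [P], [Q]. At the meeting point
    [(1 - t) * p + t * q = 0], and multiplying by [q] gives [(1 - t) * (p * q) = - (t * q ^+ 2)],
    where [t < 1] because [q] is nonzero. *)
Lemma opposite_sides_cross A B P Q :
  A != B -> opposite_sides A B P Q -> cross A B P * cross A B Q < 0.
Proof.
move=> neqAB []; rewrite !on_lineE // => /eqP P0 /eqP Q0.
case=> _ [[t [/andP[t0 t1] ->]]]; rewrite on_lineE // cross_segment.
move: (cross A B P) (cross A B Q) P0 Q0 => p q p0 q0 h.
have t_lt1 : t < 1.
  rewrite lt_neqAle t1 andbT; apply: contra_neq q0 => t_eq.
  by move: h; rewrite t_eq; lra.
rewrite lt_neqAle mulf_neq0 //= -(pmulr_rle0 _ (_ : 0 < 1 - t)) ?subr_gt0 //.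
have -> : (1 - t) * (p * q) = - (t * q ^+ 2).
  by move/(congr1 ( *%R q)): h; lra.
by rewrite oppr_le0 mulr_ge0 ?sqr_ge0.
Qed.

(** Were the product not positive, the affine function [cross A B] would vanish on the segment at
    parameter [p / (p - q)], a forbidden meeting point. *)
Lemma same_side_cross A B P Q :
  A != B -> same_side A B P Q -> 0 < cross A B P * cross A B Q.
Proof.
move=> neqAB []; rewrite !on_lineE // => /eqP P0 /eqP Q0 nmeet.
rewrite ltNge; apply/negP => le0; apply: nmeet.
pose p := cross A B P; pose q := cross A B Q.
have pq0 : p * q < 0 by rewrite lt_neqAle le0 mulf_neq0.
have d0 : 0 < (p - q) ^+ 2 by nra.
have d_neq0 : p - q != 0 by move: d0; rewrite exprn_even_gt0.
exists (P + (p / (p - q)) *: (Q - P)); split.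
  exists (p / (p - q)); split=> //.
  (* The squared denominator is positive whatever the sign of [p - q]. *)
  have -> : p / (p - q) = p * (p - q) / (p - q) ^+ 2 by field.
  by rewrite ler_pdivlMr // ler_pdivrMr // mul0r mul1r; apply/andP; split; nra.
by rewrite on_lineE // cross_segment -/p -/q; field.
Qed.

(** * Equilateral triangles on a given base *)

Definition apex k P Q : point R :=
  \row_i (if i == 0 then 2^-1 * (P 0 0 + Q 0 0) - k * (Q 0 1 - P 0 1)
          else 2^-1 * (P 0 1 + Q 0 1) + k * (Q 0 0 - P 0 0)).

(** Equal sides fix the scalar product [d] of [Q - P] and [X - P] as [n / 2]; Lagrange's identity
    then gives [cross P Q X] up to sign, and the last hypothesis selects the sign. These two
    products determine [X]. *)
Lemma equilateral_apex k P Q X : k ^+ 2 = 3 / 4 -> P != Q ->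
  equilateral P Q X -> 0 < k * cross P Q X -> X = apex k P Q.
Proof.
move=> k2 neqPQ /equilateralE[h1 h2] kpos.
pose n := sqdist P Q; have n_gt0 : 0 < n := sqdist_gt0 neqPQ.
pose d := (Q 0 0 - P 0 0) * (X 0 0 - P 0 0) + (Q 0 1 - P 0 1) * (X 0 1 - P 0 1).
have dE : d = n / 2 by move: h1 h2; rewrite /d /n /sqdist; lra.
have cE : cross P Q X = k * n.
  have : (cross P Q X - k * n) * (cross P Q X + k * n) = 0.
    have lagrange : cross P Q X ^+ 2 + d ^+ 2 = n * sqdist X P.
      by rewrite /cross /d /n /sqdist; ring.
    move: lagrange; rewrite -h2 -h1 -/n dE => lagrange.
    by move/(congr1 ( *%R (n ^+ 2))): k2; lra.
  move/eqP; rewrite mulf_eq0 subr_eq0 addr_eq0 => /orP[/eqP//|/eqP c_neg].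
  by move: kpos; rewrite c_neg; nra.
have n0 : n != 0 by rewrite gt_eqF.
apply: point_eq; rewrite !mxE /=; apply: (mulIf n0).
(* Cramer's rule: combining [d] and the cross product with the coordinates of [Q - P] as weights
   gives [n] times a coordinate of [X - P]. *)
- move/(congr1 ( *%R (Q 0 0 - P 0 0))): dE.
  by move/(congr1 ( *%R (Q 0 1 - P 0 1))): cE; rewrite /d /n /cross /sqdist; lra.
- move/(congr1 ( *%R (Q 0 1 - P 0 1))): dE.
  by move/(congr1 ( *%R (Q 0 0 - P 0 0))): cE; rewrite /d /n /cross /sqdist; lra.
Qed.

Lemma equilateral_apexP k P Q : k ^+ 2 = 3 / 4 -> equilateral P Q (apex k P Q).
Proof.
move/(congr1 ( *%R (sqdist P Q))) => k2; apply/equilateralE; move: k2.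
by rewrite /sqdist !mxE /= => k2; split; lra.
Qed.

(** * Midpoint and centroid triangles for a fixed orientation *)

Lemma midpoints_apex k A B C (A1 := apex k B C) (B1 := apex k C A)
    (C1 := apex k A B) : k ^+ 2 = 3 / 4 ->
  apex (- k) (midpoint B1 C1) (midpoint C1 A1) = C.
Proof.
(* The terms linear in [k] cancel, and [k ^+ 2] occurs only as a factor of [A + B - 2 C]; hence the
   multipliers of [k2]. *)
move=> k2; apply: point_eq.
- by move/(congr1 ( *%R (A 0 0 + B 0 0 - 2 * C 0 0))): k2; rewrite !mxE /=; lra.
- by move/(congr1 ( *%R (A 0 1 + B 0 1 - 2 * C 0 1))): k2; rewrite !mxE /=; lra.
Qed.

Lemma midpoints_equilateral k A B C (A1 := apex k B C) (B1 := apex k C A)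
    (C1 := apex k A B) : k ^+ 2 = 3 / 4 ->
  equilateral (midpoint B1 C1) (midpoint C1 A1) C.
Proof.
move=> k2; rewrite -[X in equilateral _ _ X](@midpoints_apex k A B C) //.
by apply: equilateral_apexP; rewrite sqrrN.
Qed.

Section FixedOrientation.
Variables (k : R) (A B C : point R).
Hypothesis k2 : k ^+ 2 = 3 / 4.
Let A1 := apex k B C.
Let B1 := apex k C A.
Let C1 := apex k A B.
Let A2 := midpoint B1 C1.
Let B2 := midpoint C1 A1.
Let C2 := midpoint A1 B1.
Let As := centroid A B2 C2.
Let Bs := centroid A2 B C2.
Let Cs := centroid A2 B2 C.

Lemma napoleon_equilateral :
  [/\ equilateral A2 B2 C, equilateral A B2 C2 & equilateral A2 B C2].
Proof.
split; first exact: midpoints_equilateral.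
(* Cyclic relabelling of [A], [B], [C] preserves the configuration and carries the first triangle to
   the other two. *)
- by do 2![apply: equilateral_rot]; apply: midpoints_equilateral.
- by apply: equilateral_rot; apply: midpoints_equilateral.
Qed.

Lemma apex_centroids : apex k As Bs = Cs.
Proof.
apply: point_eq.
- by move/(congr1 ( *%R (A 0 0 + B 0 0 - 2 * C 0 0))): k2; rewrite !mxE /=; lra.
- by move/(congr1 ( *%R (A 0 1 + B 0 1 - 2 * C 0 1))): k2; rewrite !mxE /=; lra.
Qed.

Lemma centroids_equilateral : equilateral As Bs Cs.
Proof. by rewrite -apex_centroids; apply: equilateral_apexP. Qed.

Lemma centroid_centroids : centroid As Bs Cs = centroid A B C.
Proof. by apply: point_eq; rewrite !mxE /=; lra. Qed.

(** Separates the parts even and odd in [k]: adding the values for [k] and [- k] leaves a quarter of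
    [cross A B C], which is the area relation. *)
Lemma cross_centroids :
  cross As Bs Cs = cross A B C / 8 +
  k / 24 * (sqdist A B + sqdist B C + sqdist C A).
Proof.
move/(congr1 ( *%R (cross A B C))): k2.
by rewrite /cross /sqdist !mxE /=; lra.
Qed.

End FixedOrientation.

(** * Orientation from the side conditions *)

Lemma cross_neq A B C : cross A B C != 0 -> [/\ A != B, B != C & C != A].
Proof.
move=> D0; split; apply: contra_neq D0.
- by move=> ->; apply: crossAA.
- by move=> ->; rewrite -cross_rot crossAA.
- by move=> ->; rewrite -2!cross_rot crossAA.
Qed.

(** The positivity hypotheses serve both configurations: the two factors are both negative in the
    non-overlapping case and both positive in the overlapping one. Cancelling the square of
    [cross A B C] leaves the sign that [equilateral_apex] requires. *)
Lemma napoleon_apex k A B C A1 B1 C1 :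
  k ^+ 2 = 3 / 4 -> cross A B C != 0 ->
  [/\ equilateral A B C1, equilateral A B1 C & equilateral A1 B C] ->
  0 < k * cross A B C * (cross A B C1 * cross A B C) ->
  0 < k * cross A B C * (cross A C B1 * cross A C B) ->
  0 < k * cross A B C * (cross B C A1 * cross B C A) ->
  [/\ A1 = apex k B C, B1 = apex k C A & C1 = apex k A B].
Proof.
move=> k2 D0 [eqC eqB eqA].
have [AB BC CA] := cross_neq D0.
(* Bases are oriented cyclically: reversing [A C] changes both signs of a product. *)
rewrite !(cross_swap C A) mulrNN (cross_rot A B C) -(cross_rot C A B).
have cancelD x : 0 < k * cross A B C * (x * cross A B C) -> 0 < k * x.
  by rewrite mulrACA pmulr_lgt0 // -expr2 exprn_even_gt0.
move=> /cancelD posC /cancelD posB /cancelD posA.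
split; apply: equilateral_apex => //.
- by apply: equilateral_rot.
- by do 2![apply: equilateral_rot].
Qed.

Lemma nonoverlapping_apex k A B C A1 B1 C1 :
  k ^+ 2 = 3 / 4 -> k * cross A B C < 0 ->
  napoleon_nonoverlapping A B C A1 B1 C1 ->
  [/\ A1 = apex k B C, B1 = apex k C A & C1 = apex k A B].
Proof.
move=> k2 kD [eqs [oppC oppB oppA]].
have D0 : cross A B C != 0 by apply: contraTneq kD => ->; rewrite mulr0 ltxx.
have [AB BC CA] := cross_neq D0.
by apply: napoleon_apex => //; rewrite nmulr_rgt0 //;
  apply: opposite_sides_cross; rewrite // eq_sym.
Qed.

Lemma overlapping_apex k A B C A1 B1 C1 :
  k ^+ 2 = 3 / 4 -> 0 < k * cross A B C ->
  napoleon_overlapping A B C A1 B1 C1 ->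
  [/\ A1 = apex k B C, B1 = apex k C A & C1 = apex k A B].
Proof.
move=> k2 kD [eqs [sameC sameB sameA]].
have D0 : cross A B C != 0 by apply: contraTneq kD => ->; rewrite mulr0 ltxx.
have [AB BC CA] := cross_neq D0.
by apply: napoleon_apex => //; rewrite pmulr_rgt0 //;
  apply: same_side_cross; rewrite // eq_sym.
Qed.

Lemma exists_orientation D : D != 0 :> R ->
  exists2 k : R, k ^+ 2 = 3 / 4 & 0 < k * D.
Proof.
move=> D0; exists (Num.sqrt (3 / 4) * Num.sg D).
  by rewrite exprMn sqr_sg D0 mulr1 sqr_sqrtr //; lra.
by rewrite -mulrA -normrEsg mulr_gt0 ?sqrtr_gt0 ?normr_gt0 //; lra.
Qed.

End NapoleonConfigurations.

Theorem theorem1 (R : realType) (A B C : point R) (hABC : ~ collinear A B C) :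
  let G := centroid A B C in
  (* parts 1 and 2 *)
  (forall A1 B1 C1 : point R, napoleon_nonoverlapping A B C A1 B1 C1 ->
     let A2 := midpoint B1 C1 in
     let B2 := midpoint C1 A1 in
     let C2 := midpoint A1 B1 in
     let As := centroid A B2 C2 in
     let Bs := centroid A2 B C2 in
     let Cs := centroid A2 B2 C in
     [/\ equilateral A2 B2 C, equilateral A B2 C2 & equilateral A2 B C2] /\
     (equilateral As Bs Cs /\ centroid As Bs Cs = G)) /\
  (* parts 3 and 4 *)
  (forall A1' B1' C1' : point R, napoleon_overlapping A B C A1' B1' C1' ->
     let A2' := midpoint B1' C1' in
     let B2' := midpoint C1' A1' in
     let C2' := midpoint A1' B1' in
     let Ass := centroid A B2' C2' in
     let Bss := centroid A2' B C2' in
     let Css := centroid A2' B2' C in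
     [/\ equilateral A2' B2' C, equilateral A B2' C2' & equilateral A2' B C2'] /\
     (equilateral Ass Bss Css /\ centroid Ass Bss Css = G)) /\
  (* parts 5, 6 and 7 *)
  (forall A1 B1 C1 A1' B1' C1' : point R,
     napoleon_nonoverlapping A B C A1 B1 C1 ->
     napoleon_overlapping A B C A1' B1' C1' ->
     let A2 := midpoint B1 C1 in
     let B2 := midpoint C1 A1 in
     let C2 := midpoint A1 B1 in
     let G1 := centroid A1 B C in
     let G2 := centroid A B1 C in
     let G3 := centroid A B C1 in
     let As := centroid A B2 C2 in
     let Bs := centroid A2 B C2 in
     let Cs := centroid A2 B2 C in
     let A2' := midpoint B1' C1' in
     let B2' := midpoint C1' A1' in
     let C2' := midpoint A1' B1' in
     let G1' := centroid A1' B C in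
     let G2' := centroid A B1' C in
     let G3' := centroid A B C1' in
     let Ass := centroid A B2' C2' in
     let Bss := centroid A2' B C2' in
     let Css := centroid A2' B2' C in
     let h := homothety G (- (1 / 2)) in
     [/\ h G1' = As, h G2' = Bs & h G3' = Cs] /\
     [/\ h G1 = Ass, h G2 = Bss & h G3 = Css] /\
     signed_area A B C = 4 * (signed_area As Bs Cs + signed_area Ass Bss Css)).
Proof.
(* With [k] of the sign of the triangle, the overlapping apices have parameter [k] and the others
   [- k]. *)
have [k k2 kD] := exists_orientation (noncollinear_cross hABC).
have Nk2 : (- k) ^+ 2 = 3 / 4 by rewrite sqrrN.
have NkD : - k * cross A B C < 0 by rewrite mulNr oppr_lt0.
move=> G; split; last split.
- move=> A1 B1 C1 /(nonoverlapping_apex Nk2 NkD)[-> -> ->].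
  by split; [exact: napoleon_equilateral|split;
    [exact: centroids_equilateral|exact: centroid_centroids]].
- move=> A1 B1 C1 /(overlapping_apex k2 kD)[-> -> ->].
  by split; [exact: napoleon_equilateral|split;
    [exact: centroids_equilateral|exact: centroid_centroids]].
move=> A1 B1 C1 A1' B1' C1' /(nonoverlapping_apex Nk2 NkD)[-> -> ->].
move=> /(overlapping_apex k2 kD)[-> -> ->].
split; [|split].
(* Both sides are affine in [k]; the negative ratio of the homothety accounts for the passage
   between [k] and [- k]. *)
- by split; apply: point_eq; rewrite !mxE /=; field.
- by split; apply: point_eq; rewrite !mxE /=; field.
by rewrite !signed_areaE !cross_centroids //; field.
Qed.
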